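(* Let $A\in\mathbb{R}^{n\times n}$ be a symmetric matrix with eigenvalues $\lambda_1\le\cdots\le\lambda_n$ and with diagonal entries listed in non-decreasing order as $d_1\le\cdots\le d_n$. If $A$ satisfies the strict majorization condition $$\lambda_1+\cdots+\lambda_k<d_1+\cdots+d_k\quad (k=1,\dots,n-1),\qquad \lambda_1+\cdots+\lambda_n=d_1+\cdots+d_n,$$ then $A$ is strongly Schur-Horn continuous.
   Context: $\|\cdot\|_{\mathrm F}$ is the Frobenius norm; $\mathrm{diag}(M)$ is the vector of diagonal entries of a matrix $M$. Big-$O$ convention: $\varepsilon>0$ is the asymptotic variable tending to zero; perturbed quantities are families indexed by sufficiently small $\varepsilon>0$; all other data (matrix dimension, the matrix $A$) are constants. Definition (strong Schur-Horn continuity). Suppose $A\in\mathbb{R}^{n\times n}$ is a symmetric matrix with an eigendecomposition $A=Q\Lambda Q^\top$, where $Q$ is the orthonormal eigenvector matrix and $\Lambda$ is the diagonal eigenvalue matrix. $A$ is strongly Schur-Horn continuous if, for any perturbed eigenvalues $\widetilde\Lambda$ (a real diagonal matrix) satisfying $\mathrm{tr}(\widetilde\Lambda)=\mathrm{tr}(\Lambda)$ and $\|\widetilde\Lambda-\Lambda\|_{\mathrm F}=O(\varepsilon)$ for $\varepsilon>0$ sufficiently small, there exists a symmetric matrix $\widetilde B=G_2QG_1\widetilde\Lambda G_1^\top Q^\top G_2^\top$ such that (1) $\mathrm{diag}(\widetilde B)=\mathrm{diag}(A)$; (2) $G_1$ and $G_2$ are orthogonal matrices; (3) $\|G_i-I\|_{\mathrm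 F}=O(\varepsilon^{1/2})$ for $i=1,2$. *)

(* Defs.v *)
From HB Require Import structures.
From mathcomp Require Export all_boot all_order all_algebra.
From mathcomp Require Export sesquilinear.
From mathcomp Require Export all_classical all_reals all_analysis.

Set Implicit Arguments.
Unset Strict Implicit.
Unset Printing Implicit Defensive.

Export Order.TTheory GRing.Theory Num.Theory.
Export numFieldNormedType.Exports.

Local Open Scope classical_set_scope.
Local Open Scope ring_scope.

(* The norm [`|M|] that MathComp-Analysis puts on matrices is the sup norm. *)
Definition frobenius_norm (R : realType) (m n : nat) (M : 'M[R]_(m, n)) : R :=
  Num.sqrt (\sum_(i < m) \sum_(j < n) M i j ^+ 2).

Definition diag_entries (R : realType) (n : nat) (M : 'M[R]_n) : 'rV[R]_n :=
  \row_i M i i.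

(* The library's [unitarymx] is only available over closed fields. *)
Definition is_orthogonal_mx (R : realType) (n : nat) (G : 'M[R]_n) : Prop :=
  G *m G^T = 1%:M.

Definition is_eigendecomposition (R : realType) (n : nat)
    (A Q Lambda : 'M[R]_n) : Prop :=
  [/\ is_orthogonal_mx Q, is_diag_mx Lambda & A = Q *m Lambda *m Q^T].

(* An epsilon-dependent matrix is a function on R, of which only the germ at
   0^'+ matters: constraints are imposed for all sufficiently small positive
   epsilon.
   The property is required of every eigendecomposition of A; symmetry of A is
   included since a matrix with no eigendecomposition would otherwise satisfy
   it vacuously. *)
Definition strongly_Schur_Horn_continuous (R : realType) (n : nat)
    (A : 'M[R]_n) : Prop :=
  A \is symmetricmx /\
  forall Q Lambda : 'M[R]_n, is_eigendecomposition A Q Lambda ->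
  forall Lambda_t : R -> 'M[R]_n,
    (\forall eps \near 0^'+,
       is_diag_mx (Lambda_t eps) /\ \tr (Lambda_t eps) = \tr Lambda) ->
    (fun eps : R => frobenius_norm (Lambda_t eps - Lambda))
      =O_ (0^'+) (fun eps : R => eps) ->
  exists B_t G1 G2 : R -> 'M[R]_n,
    [/\ (\forall eps \near 0^'+,
           [/\ B_t eps \is symmetricmx,
               B_t eps = G2 eps *m Q *m G1 eps *m Lambda_t eps
                         *m (G1 eps)^T *m Q^T *m (G2 eps)^T,
               diag_entries (B_t eps) = diag_entries A,
               is_orthogonal_mx (G1 eps) &
               is_orthogonal_mx (G2 eps)]),
        (fun eps : R => frobenius_norm (G1 eps - 1%:M))
          =O_ (0^'+) (fun eps : R => Num.sqrt eps) &
        (fun eps : R => frobenius_norm (G2 eps - 1%:M))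
          =O_ (0^'+) (fun eps : R => Num.sqrt eps)].

(* Main.v *)
Require Import Defs.
From mathcomp Require Import perm ring lra.

(** We take [G1 = 1] and look for [G2] moving the diagonal of
    [M = Q Lambda_t Q^T], a perturbation of size [O(eps)] of [A], back to the
    diagonal of [A].  A rotation in the plane of two orthonormal vectors [u],
    [v] transfers an amount [x] from [u^T M u] to [v^T M v].  It can be realised
    exactly by a small angle in two situations: with an angle [O(|x|)] for
    either sign of [x] when [u^T A v <> 0], and with an angle [O(sqrt x)] for
    [x >= 0] when [u^T A u > v^T A v].

    Let the blocks be the connected components of the graph of nonzero entries
    of [A].  Projections of eigenvectors on blocks are eigenvectors, so, in the
    second situation, mass can be transferred from one block to another as soon
    as some eigenvalue of the first exceeds some eigenvalue of the second.  If
    the digraph of these moves were not strongly connected, there would be a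
    union [S] of blocks carrying the [#|S|] smallest eigenvalues, and the sum of
    the diagonal entries over [S] would equal the sum of these eigenvalues,
    against strict majorization.  Hence rotations of angle [O(sqrt eps)] restore
    the trace of each block; after that the diagonal defects are
    [O(sqrt eps)], and coordinate rotations along the edges inside each block
    remove them exactly. *)

Set Implicit Arguments.
Unset Strict Implicit.
Unset Printing Implicit Defensive.

Local Open Scope classical_set_scope.
Local Open Scope ring_scope.

(** * Plane rotations and their extension to dimension [n] *)

(* With [t] the tangent of the angle, the equation is
   [(b - a + d) t^2 + 2 m t + d = 0]; of its two roots we take the one of
   smaller absolute value, in the form [- d / q] which stays meaningful when
   the leading coefficient vanishes. *)
Lemma small_rotation (R : realType) (a b m d tau : R) :
  let D := m ^+ 2 + d * (a - b - d) in
  0 <= D -> `|d| <= tau * `|m| \/ `|d| <= tau * Num.sqrt D -> 0 <= tau ->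
  exists c s : R, [/\ c ^+ 2 + s ^+ 2 = 1, `|c - 1| <= tau, `|s| <= tau &
    c ^+ 2 * a + 2 * c * s * m + s ^+ 2 * b = a - d].
Proof.
move=> D D0 dtau tau0.
pose r := Num.sqrt D.
have r0 : 0 <= r by exact: sqrtr_ge0.
have r2 : r ^+ 2 = D by exact: sqr_sqrtr.
(* The sign put before [r] is that of [m], so that nothing cancels and [q] dominates both [m] and
   [r]. *)
have [q [q_eq q_m q_r]] : exists q : R,
    [/\ q ^+ 2 - 2 * m * q + d * (a - b - d) * (-1) = 0, `|m| <= `|q| & r <= `|q|].
  have [m0|m0] := lerP 0 m.
    exists (m + r); rewrite (ger0_norm m0) ger0_norm ?addr_ge0//.
    split; [|lra|lra].
    have -> : (m + r) ^+ 2 = m ^+ 2 + 2 * m * r + r ^+ 2 by ring.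
    by rewrite r2 /D; ring.
  exists (m - r); rewrite (ltr0_norm m0) ler0_norm; last lra.
  split; [|lra|lra].
  have -> : (m - r) ^+ 2 = m ^+ 2 - 2 * m * r + r ^+ 2 by ring.
  by rewrite r2 /D; ring.
have dq : `|d| <= tau * `|q|.
  by case: dtau => /le_trans; apply; apply: ler_wpM2l.
pose t := - d / q.
have [t_tau t_eq] : `|t| <= tau /\ (b - a + d) * t ^+ 2 + 2 * m * t + d = 0.
  (* If [q = 0], the bound [dq] forces [d = 0], hence [t = 0] and no rotation is made. *)
  have [q0|q0] := eqVneq q 0.
    have d0 : d = 0.
      by move: dq; rewrite q0 normr0 mulr0 normr_le0 => /eqP.
    by rewrite /t d0 oppr0 mul0r normr0; split => //; ring.
  split.
    by rewrite /t normrM normrN normfV ler_pdivrMr ?normr_gt0.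
  have -> : (b - a + d) * t ^+ 2 + 2 * m * t + d =
      d / q ^+ 2 * (q ^+ 2 - 2 * m * q + d * (a - b - d) * (-1)).
    by rewrite /t; field.
  by rewrite q_eq mulr0.
pose w := Num.sqrt (1 + t ^+ 2).
have w2 : w ^+ 2 = 1 + t ^+ 2 by rewrite sqr_sqrtr// addr_ge0// sqr_ge0.
have w1 : 1 <= w.
  by rewrite -[leLHS]sqrtr1 /w ler_wsqrtr// lerDl sqr_ge0.
have w0 : w != 0 by apply: lt0r_neq0; lra.
have winv0 : 0 < w^-1 by rewrite invr_gt0; lra.
have winv1 : w^-1 <= 1 by rewrite invf_le1//; lra.
have cs1 : w^-1 ^+ 2 + (t / w) ^+ 2 = 1.
  have -> : w^-1 ^+ 2 + (t / w) ^+ 2 = (1 + t ^+ 2) / w ^+ 2 by field.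
  by rewrite w2 divff// -w2 expf_neq0.
have s_tau : `|t / w| <= tau.
  rewrite normrM normfV (@ger0_norm _ w); last lra.
  by apply: le_trans t_tau; apply: ler_piMr => //; case/andP: winv.
exists w^-1, (t / w); split => //.
  apply: le_trans s_tau.
  rewrite ler0_norm; last lra.
  (* With [s = t / w], [s ^+ 2 <= |s|] gives [(1 - |s|) ^+ 2 <= 1 - s ^+ 2], which is the squared
     cosine; hence [1 - c <= |s|]. *)
  have : (1 - `|t / w|) ^+ 2 <= w^-1 ^+ 2.
    rewrite sqrrB expr1n mul1r real_normK ?num_real//.
    have : `|t / w| ^+ 2 <= `|t / w|.
      rewrite expr2; apply: ler_piMr => //.
      rewrite -(@ler_pXn2r _ 2) ?nnegrE// expr1n real_normK ?num_real//.
      by have := sqr_ge0 w^-1; lra.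
    by rewrite real_normK ?num_real//; lra.
  have [|h] := lerP (1 - `|t / w|) 0; first lra.
  rewrite ler_pXn2r ?nnegrE; [move=> ?; lra| by []| exact: ltW | exact: ltW].
have -> : w^-1 ^+ 2 * a + 2 * w^-1 * (t / w) * m + (t / w) ^+ 2 * b =
  (a + 2 * t * m + t ^+ 2 * b) / w ^+ 2 by field.
apply: (mulIf (expf_neq0 2 w0)); rewrite divfK ?expf_neq0// w2.
apply/eqP; rewrite -subr_eq0 -[X in _ == X]t_eq; apply/eqP; ring.
Qed.

Definition rot2 (R : realType) (c s : R) : 'M[R]_2 :=
  \matrix_(i, j) if i == j then c else if i == 0 then s else - s.

Lemma rot2_conj (R : realType) (c s : R) (N : 'M[R]_2) :
    N^T = N -> c ^+ 2 + s ^+ 2 = 1 ->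
  let N' := rot2 c s *m N *m (rot2 c s)^T in
  N' 0 0 = c ^+ 2 * N 0 0 + 2 * c * s * N 0 1 + s ^+ 2 * N 1 1 /\
  N' 0 0 + N' 1 1 = N 0 0 + N 1 1.
Proof.
move=> Nsym cs1 N'; rewrite /N'.
have N10 : N 1 0 = N 0 1 by rewrite -[in LHS]Nsym mxE.
rewrite !mxE !big_ord_recl !big_ord0 !mxE !big_ord_recl !big_ord0 !mxE /=.
have -> : lift ord0 ord0 = 1 :> 'I_2 by apply: val_inj.
rewrite -?[ord0]/(0 : 'I_2) /= N10; split; first ring.
rewrite -[in RHS](mul1r (N 0 0 + _)) -cs1; ring.
Qed.

Lemma rot2_orthogonal (R : realType) (c s : R) :
  c ^+ 2 + s ^+ 2 = 1 -> is_orthogonal_mx (rot2 c s).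
Proof.
move=> cs1; rewrite /is_orthogonal_mx; apply/matrixP => i j.
rewrite !mxE !big_ord_recl !big_ord0 !mxE /=.
case: i => [[|[|//]] ?]; case: j => [[|[|//]] ?]; rewrite /= -?cs1; ring.
Qed.

Section plane_rotation.
Variables (R : realType) (n m : nat) (K : 'M[R]_(n, m)) (r : 'M[R]_m).
Hypotheses (KK : K^T *m K = 1%:M) (r_orth : is_orthogonal_mx r).

(** For orthonormal columns of [K], this acts as [r] in that basis of their span and as the identity
    on the orthogonal complement. *)
Definition extend_mx : 'M[R]_n := 1%:M + K *m (r - 1%:M) *m K^T.

Lemma extend_mxK : extend_mx *m K = K *m r.
Proof.
by rewrite /extend_mx mulmxDl mul1mx -!mulmxA KK mulmx1 mulmxBr mulmx1 addrC subrK.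
Qed.

Lemma tr_mul_extend_mx : K^T *m extend_mx = r *m K^T.
Proof.
by rewrite /extend_mx mulmxDr mulmx1 !mulmxA KK mul1mx mulmxBl mul1mx addrC subrK.
Qed.

Lemma extend_mx_orthogonal : is_orthogonal_mx extend_mx.
Proof.
rewrite /is_orthogonal_mx {2}/extend_mx linearD /= trmx1 mulmxDr mulmx1.
rewrite !trmx_mul trmxK !mulmxA extend_mxK linearB /= trmx1.
rewrite /extend_mx -addrA -mulmxDl.
have -> : K *m (r - 1%:M) + K *m r *m (r^T - 1%:M) = 0.
  by rewrite -mulmxA -mulmxDr mulmxBr r_orth mulmx1 addrA subrK subrr mulmx0.
by rewrite mul0mx addr0.
Qed.

(** [P] preserves the span of [K], where it acts as [E]. The remainder [P0 = P - K E K^T] vanishes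
    on that span, so the conjugation leaves its contribution unchanged, and only the [m]-dimensional
    compression of [M] matters. Class traces are the case where [P] is a diagonal indicator
    matrix. *)
Lemma tr_extend_mx_conj (P M : 'M[R]_n) (E : 'M[R]_m) :
    P^T = P -> E^T = E -> P *m K = K *m E ->
  \tr (P *m (extend_mx *m M *m extend_mx^T)) =
  \tr (P *m M) + \tr (E *m (r *m (K^T *m M *m K) *m r^T - K^T *m M *m K)).
Proof.
move=> Psym Esym PK.
have KP : K^T *m P = E *m K^T.
  by rewrite -[P]Psym -trmx_mul PK trmx_mul Esym.
pose P0 := P - K *m E *m K^T.
have P0K : P0 *m K = 0.
  by rewrite mulmxBl -!mulmxA KK mulmx1 PK subrr.
have KP0 : K^T *m P0 = 0.
  by rewrite mulmxBr !mulmxA KK mul1mx KP subrr.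
have P0G : P0 *m extend_mx = P0.
  by rewrite mulmxDr mulmx1 !mulmxA P0K !mul0mx addr0.
have GP0 : extend_mx^T *m P0 = P0.
  by rewrite /extend_mx [(_ + _)^T]linearD /= trmx1 mulmxDl mul1mx !trmx_mul trmxK
    -!mulmxA KP0 !mulmx0 addr0.
have Pdec : P = P0 + K *m E *m K^T by rewrite subrK.
move: (P0) P0K KP0 P0G GP0 Pdec => {}P0 _ _ P0G GP0 ->.
rewrite !(mulmxDl P0) !mxtraceD -addrA; congr (_ + _).
  by rewrite !mulmxA P0G mxtrace_mulC mulmxA GP0.
rewrite mulmxBr linearB /= addrC.
have trE X : \tr (K *m E *m K^T *m X) = \tr (E *m (K^T *m X *m K)).
  by rewrite -!mulmxA mxtrace_mulC !mulmxA.
rewrite !trE subrK; congr (\tr (E *m _)).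
have KG : extend_mx^T *m K = K *m r^T.
  by apply: trmx_inj; rewrite !trmx_mul !trmxK tr_mul_extend_mx.
by rewrite !mulmxA tr_mul_extend_mx -!mulmxA KG.
Qed.
End plane_rotation.

(** * Asymptotic bounds at [0^'+], entrywise for matrices *)

Section asymptotics.
Variable R : realType.
Implicit Types (f g x y : R -> R).

Lemma eqO_add f x y :
  x =O_ (0^'+) f -> y =O_ (0^'+) f -> (fun e => x e + y e) =O_ (0^'+) f.
Proof.
move=> /eqO_exP[k k0 xf] /eqO_exP[l l0 yf]; apply/eqO_exP.
exists (k + l); first exact: addr_gt0.
near=> e; rewrite mulrDl (le_trans (ler_normD _ _))// lerD//.
- by near: e.
- by near: e.
Unshelve. all: by end_near. Qed.

Lemma eqO_mul f g x y : x =O_ (0^'+) f -> y =O_ (0^'+) g ->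
  (fun e => x e * y e) =O_ (0^'+) (fun e => f e * g e).
Proof.
move=> /eqO_exP[k k0 xf] /eqO_exP[l l0 yg]; apply/eqO_exP.
exists (k * l); first exact: mulr_gt0.
near=> e; rewrite !normrM mulrACA ler_pM//.
- by near: e.
- by near: e.
Unshelve. all: by end_near. Qed.

Lemma eqO_sum f (I : Type) (s : seq I) (x : I -> R -> R) :
  (forall i, x i =O_ (0^'+) f) -> (fun e => \sum_(i <- s) x i e) =O_ (0^'+) f.
Proof.
move=> xf; elim: s => [|i s IHs].
  apply/eqO_exP; exists 1 => //; near=> e.
  by rewrite big_nil normr0 mulr_ge0.
under eq_fun do rewrite big_cons; exact: eqO_add.
Unshelve. all: by end_near. Qed.

Lemma near_sqrt_small (d : R) : 0 < d -> \forall e \near 0^'+, Num.sqrt e < d.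
Proof.
move=> d0; near=> e.
rewrite -(@ltr_pXn2r _ 2) ?nnegrE ?sqrtr_ge0 ?(ltW d0)// sqr_sqrtr.
  by near: e; apply: nbhs_right_lt; rewrite exprn_gt0.
by near: e; exact: nbhs_right_ge.
Unshelve. all: by end_near. Qed.

Lemma eqO_le f g x : (\forall e \near 0^'+, `|f e| <= `|g e|) ->
  x =O_ (0^'+) f -> x =O_ (0^'+) g.
Proof.
move=> fg /eqO_exP[k k0 xf]; apply/eqO_exP; exists k => //; near=> e.
have /le_trans -> // : `|x e| <= k * `|f e| by near: e.
by rewrite ler_pM2l//; near: e.
Unshelve. all: by end_near. Qed.

Lemma eqO_sqrt_cst x : x =O_ (0^'+) Num.sqrt -> x =O_ (0^'+) (fun=> 1 : R).
Proof.
apply: eqO_le; near=> e; rewrite ger0_norm ?sqrtr_ge0// normr1 ltW//.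
by near: e; exact: near_sqrt_small.
Unshelve. all: by end_near. Qed.

Lemma eqO_id_sqrt x : x =O_ (0^'+) (fun e : R => e) -> x =O_ (0^'+) Num.sqrt.
Proof.
apply: eqO_le; near=> e; have e0 : 0 <= e by near: e; exact: nbhs_right_ge.
rewrite !ger0_norm ?sqrtr_ge0// -[leLHS]sqr_sqrtr// expr2 ler_piMl ?sqrtr_ge0//.
by rewrite ltW//; near: e; exact: near_sqrt_small.
Unshelve. all: by end_near. Qed.

(** Makes a family out of rotations that are constructed for each small [e] separately. *)
Lemma near_choice (T : pointedType) (P : R -> T -> Prop) :
  (\forall e \near 0^'+, exists t, P e t) ->
  exists t, \forall e \near 0^'+, P e (t e).
Proof.
move=> exP; exists (fun e => get (P e)); apply: filterS exP => e [t Pt].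
exact: (@getPex _ (P e) (ex_intro _ t Pt)).
Qed.

Definition mxO f m n (X : R -> 'M[R]_(m, n)) :=
  forall i j, (fun e => X e i j) =O_ (0^'+) f.

Lemma mxO_add f m n (X Y : R -> 'M[R]_(m, n)) :
  mxO f X -> mxO f Y -> mxO f (fun e => X e + Y e).
Proof.
move=> Xf Yf i j; under eq_fun do rewrite mxE; exact: eqO_add.
Qed.

Lemma mxO_mul f g m n p (X : R -> 'M[R]_(m, n)) (Y : R -> 'M[R]_(n, p)) :
  mxO f X -> mxO g Y -> mxO (fun e => f e * g e) (fun e => X e *m Y e).
Proof.
move=> Xf Yg i j; under eq_fun do rewrite mxE.
by apply: eqO_sum => k; exact: eqO_mul.
Qed.

Lemma mxO_mull f m n p (X : R -> 'M[R]_(m, n)) (Y : R -> 'M[R]_(n, p)) :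
  mxO (fun=> 1) X -> mxO f Y -> mxO f (fun e => X e *m Y e).
Proof.
move=> X1 Yf; suff -> : f = (fun e => 1 * f e) by exact: mxO_mul.
by apply/funext => e; rewrite mul1r.
Qed.

Lemma mxO_mulr f m n p (X : R -> 'M[R]_(m, n)) (Y : R -> 'M[R]_(n, p)) :
  mxO f X -> mxO (fun=> 1) Y -> mxO f (fun e => X e *m Y e).
Proof.
move=> Xf Y1; suff -> : f = (fun e => f e * 1) by exact: mxO_mul.
by apply/funext => e; rewrite mulr1.
Qed.

Lemma mxO_tr f m n (X : R -> 'M[R]_(m, n)) :
  mxO f X -> mxO f (fun e => (X e)^T).
Proof. by move=> Xf i j; under eq_fun do rewrite mxE. Qed.

Lemma mxO_cst m n (X : 'M[R]_(m, n)) : mxO (fun=> 1) (fun=> X).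
Proof.
move=> i j; apply/eqO_exP; exists (`|X i j| + 1); first by rewrite ltr_wpDl.
by near=> e; rewrite normr1 mulr1 lerDl.
Unshelve. all: by end_near. Qed.

Lemma mxO_sqrt_cst m n (X : R -> 'M[R]_(m, n)) :
  mxO Num.sqrt X -> mxO (fun=> 1) X.
Proof. by move=> XO i j; exact: eqO_sqrt_cst. Qed.

Lemma mxO_near f m n (X Y : R -> 'M[R]_(m, n)) :
  (\forall e \near 0^'+, X e = Y e) -> mxO f X -> mxO f Y.
Proof.
move=> XY XO i j; have /eqO_exP[C C0 Xf] := XO i j; apply/eqO_exP.
by exists C => //; apply: filterS2 Xf XY => e Xe <-.
Qed.

Lemma mxO_uniform f m n (X : R -> 'M[R]_(m, n)) : mxO f X ->
  exists2 C, 0 < C & \forall e \near 0^'+, forall i j, `|X e i j| <= C * `|f e|.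
Proof.
move=> XO.
have /choice[C CP] : forall ij : 'I_m * 'I_n, exists C : R,
    0 < C /\ \forall e \near 0^'+, `|X e ij.1 ij.2| <= C * `|f e|.
  by move=> [i j] /=; have /eqO_exP[C] := XO i j; exists C.
exists (1 + \sum_ij C ij).
  by rewrite ltr_wpDr// sumr_ge0// => ij _; exact/ltW/(CP ij).1.
have : \forall e \near 0^'+, forall ij, `|X e ij.1 ij.2| <= C ij * `|f e|.
  by apply: filter_forall => ij; exact: (CP ij).2.
apply: filterS => e Xe i j; apply: le_trans (Xe (i, j)) _.
rewrite ler_wpM2r// (bigD1 (i, j))//= addrCA lerDl addr_ge0// sumr_ge0// => ij _.
exact/ltW/(CP ij).1.
Qed.

Lemma mxO_frobenius f m n (X : R -> 'M[R]_(m, n)) :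
  (fun e => frobenius_norm (X e)) =O_ (0^'+) f <-> mxO f X.
Proof.
split=> [/eqO_exP[C C0 XO] i j|/mxO_uniform[C C0 XO]].
  apply/eqO_exP; exists C => //; apply: filterS XO => e; apply: le_trans.
  rewrite [leRHS]ger0_norm ?sqrtr_ge0// -sqrtr_sqr ler_wsqrtr//.
  rewrite (bigD1 i)//= (bigD1 j)//= -addrA lerDl addr_ge0// sumr_ge0// => *.
    exact: sqr_ge0.
  by apply: sumr_ge0 => *; exact: sqr_ge0.
(* Each of the [m * n] squares is at most [(C * |f e|) ^+ 2]; the added [1] keeps the constant
   positive for an empty matrix. *)
apply/eqO_exP; exists (1 + Num.sqrt (m * n)%:R * C).
  by rewrite ltr_wpDr// mulr_ge0 ?sqrtr_ge0 ?ltW.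
apply: filterS XO => e Xe; rewrite ger0_norm ?sqrtr_ge0//.
apply: (@le_trans _ _ (Num.sqrt (m * n)%:R * C * `|f e|)); last first.
  by rewrite ler_wpM2r// lerDr.
have Cf : 0 <= C * `|f e| by rewrite mulr_ge0// ltW.
rewrite -mulrA -[X in _ * X](ger0_norm Cf) -sqrtr_sqr -sqrtrM//.
rewrite ler_wsqrtr// natrM -mulrA mulr_natl -[in leRHS](card_ord m) -sumr_const.
apply: ler_sum => i _; rewrite mulr_natl -[in leRHS](card_ord n) -sumr_const.
apply: ler_sum => j _.
by rewrite -[leLHS]real_normK ?num_real// ler_pXn2r ?nnegrE.
Qed.
End asymptotics.

(** * One transfer of diagonal mass by a rotation of angle [O(sqrt eps)] *)

Section transfers.
Variables (R : realType) (n : nat) (A : 'M[R]_n).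
Implicit Types (M : R -> 'M[R]_n) (x : R -> R).

(** Invariant of the successive moves: a nonzero entry or a strict gap of [A] survives in [M e] for
    small [e]. *)
Definition sqrt_close M :=
  (\forall e \near 0^'+, (M e)^T = M e) /\ mxO Num.sqrt (fun e => M e - A).

Definition sqrt_conj M M' := exists G : R -> 'M[R]_n,
  (\forall e \near 0^'+, is_orthogonal_mx (G e) /\ M' e = G e *m M e *m (G e)^T) /\
  mxO Num.sqrt (fun e => G e - 1%:M).

Lemma mxO_cst_of_sub (B : 'M[R]_n) M :
  mxO Num.sqrt (fun e => M e - B) -> mxO (fun=> 1) M.
Proof.
move=> /mxO_sqrt_cst MB; apply: mxO_near (mxO_add MB (mxO_cst B)).
by apply: nearW => e; rewrite subrK.
Qed.

Lemma sqrt_conj_refl M : sqrt_conj M M.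
Proof.
exists (fun=> 1%:M); split.
  by apply: nearW => e; rewrite /is_orthogonal_mx trmx1 !mulmx1 mul1mx.
move=> i j; apply/eqO_exP; exists 1 => //; apply: nearW => e.
by rewrite subrr mxE normr0 mulr_ge0.
Qed.

Lemma sqrt_conj_trans M1 M2 M3 : sqrt_conj M1 M2 -> sqrt_conj M2 M3 -> sqrt_conj M1 M3.
Proof.
move=> [G [GM GO]] [H [HM HO]]; exists (fun e => H e *m G e); split.
  apply: filterS2 GM HM => e [Gorth ->] [Horth ->]; split.
    rewrite /is_orthogonal_mx trmx_mul mulmxA -(mulmxA (H e)).
    by rewrite (Gorth : _ *m _ = _) mulmx1.
  by rewrite trmx_mul !mulmxA.
apply: mxO_near (mxO_add (mxO_mulr HO (mxO_cst_of_sub GO)) GO).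
by apply: nearW => e; rewrite mulmxBl mul1mx addrA subrK.
Qed.

Lemma sqrt_conj_close M M' : sqrt_close M -> sqrt_conj M M' -> sqrt_close M'.
Proof.
move=> [Msym MO] [G [GM GO]]; split.
  apply: filterS2 GM Msym => e [_ ->] Msym.
  by rewrite !trmx_mul trmxK Msym mulmxA.
have M1 := mxO_cst_of_sub MO; have G1 := mxO_cst_of_sub GO.
(* Uses [G M G^T - A = (G - 1) M G^T + M (G - 1)^T + (M - A)], each term being [O(sqrt e)]. *)
have h1 := mxO_mulr (mxO_mulr GO M1) (mxO_tr G1).
have h2 := mxO_mull M1 (mxO_tr GO).
apply: mxO_near (mxO_add (mxO_add h1 h2) MO).
apply: filterS GM => e [_ ->]; rewrite linearB /= trmx1 mulmxBr mulmx1.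
by rewrite !mulmxBl mul1mx !addrA !subrK.
Qed.

(** Supplies the hypotheses of [small_rotation] with [tau = T * sqrt e]. If [m0 != 0], [m e] stays
    away from [0] and [m e ^+ 2] dominates the rest of [D]. If [b0 < a0] and [d >= 0], then
    [D >= g * d] for a fixed [g > 0], so [d ^+ 2 <= C * e * d <= (C / g) * e * D]. *)
Lemma small_angle (a b m d : R -> R) (a0 b0 m0 : R) :
    (fun e => a e - a0) =O_ (0^'+) Num.sqrt ->
    (fun e => b e - b0) =O_ (0^'+) Num.sqrt ->
    (fun e => m e - m0) =O_ (0^'+) Num.sqrt ->
    (m0 != 0 /\ d =O_ (0^'+) Num.sqrt) \/
    [/\ b0 < a0, \forall e \near 0^'+, 0 <= d e & d =O_ (0^'+) (fun e : R => e)] ->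
  exists2 T, 0 <= T & \forall e \near 0^'+,
    let D := m e ^+ 2 + d e * (a e - b e - d e) in
    0 <= D /\ (`|d e| <= T * Num.sqrt e * `|m e| \/
               `|d e| <= T * Num.sqrt e * Num.sqrt D).
Proof.
move=> /eqO_exP[Ca Ca0 aO] /eqO_exP[Cb Cb0 bO] /eqO_exP[Cm Cm0 mO] dO.
have small C g : 0 < C -> 0 < g ->
    \forall e \near (0 : R)^'+, C * `|Num.sqrt e| < g.
  move=> C0 g0; have := @near_sqrt_small R _ (divr_gt0 g0 C0).
  apply: filterS => e; rewrite ltr_pdivlMr// mulrC.
  by rewrite ger0_norm ?sqrtr_ge0.
case: dO => [[m0n /eqO_exP[C C0 dO]]|[ab0 d0 dO]].
  pose g := `|m0| / 2; have g0 : 0 < g by rewrite divr_gt0 ?normr_gt0.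
  (* The [3] absorbs the deviations of [a] and [b] and the size of [d], each eventually below
     [1]. *)
  pose H := `|a0 - b0| + 3.
  have H0 : 0 < H by rewrite ltr_wpDl.
  exists (C / g); first by rewrite divr_ge0// ltW.
  near=> e; pose D := m e ^+ 2 + d e * (a e - b e - d e); rewrite -/D.
  have mg : g <= `|m e|.
    have h1 : `|m e - m0| <= Cm * `|Num.sqrt e| by near: e.
    have h2 : Cm * `|Num.sqrt e| < g by near: e; exact: small.
    have := ler_normB (m e) (m e - m0); rewrite opprB addrC subrK.
    rewrite /g in h2 *; lra.
  have dC : `|d e| <= C * `|Num.sqrt e| by near: e.
  have abd : `|a e - b e - d e| <= H.
    have h1 : `|a e - a0| <= Ca * `|Num.sqrt e| by near: e.
    have h2 : `|b e - b0| <= Cb * `|Num.sqrt e| by near: e.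
    have h3 : Ca * `|Num.sqrt e| < 1 by near: e; exact: small.
    have h4 : Cb * `|Num.sqrt e| < 1 by near: e; exact: small.
    have h5 : C * `|Num.sqrt e| < 1 by near: e; exact: small.
    have -> : a e - b e - d e = (a0 - b0) + (a e - a0) - (b e - b0) - d e by ring.
    rewrite /H (le_trans (ler_normB _ _))//.
    have := ler_normB (a0 - b0 + (a e - a0)) (b e - b0).
    have := ler_normD (a0 - b0) (a e - a0); lra.
  have dH : `|d e * (a e - b e - d e)| <= g ^+ 2.
    rewrite normrM; apply: (@le_trans _ _ (C * `|Num.sqrt e| * H)).
      by rewrite ler_pM.
    have : C * H * `|Num.sqrt e| < g ^+ 2.
      by near: e; apply: small; [exact: mulr_gt0 | exact: exprn_gt0].
    by rewrite mulrAC => /ltW.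
  have mg2 : g ^+ 2 <= m e ^+ 2.
    by rewrite -[leRHS]real_normK ?num_real// ler_pXn2r ?nnegrE// ltW.
  split; first by rewrite /D; move: dH; rewrite ler_norml => /andP[]; lra.
  left; apply: le_trans dC _; rewrite ger0_norm ?sqrtr_ge0//.
  rewrite mulrAC ler_wpM2r ?sqrtr_ge0// -mulrA ler_peMr ?(ltW C0)//.
  by rewrite mulrC ler_pdivlMr// mul1r.
have dS := eqO_id_sqrt dO.
move/eqO_exP: dS => [C1 C10 dS]; move/eqO_exP: dO => [C C0 dO].
pose g := (a0 - b0) / 2; have g0 : 0 < g by rewrite divr_gt0 ?subr_gt0.
(* The limit gap is [2 * g]; three errors below [g / 3] leave at least [g]. *)
have g3 : 0 < g / 3 by exact: divr_gt0.
exists (Num.sqrt (C / g)); first exact: sqrtr_ge0.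
near=> e; pose D := m e ^+ 2 + d e * (a e - b e - d e); rewrite -/D.
have e0 : 0 <= e by near: e; exact: nbhs_right_ge.
have d0e : 0 <= d e by near: e.
have dC : `|d e| <= C * `|e| by near: e.
have abd : g <= a e - b e - d e.
  have h1 : `|a e - a0| <= Ca * `|Num.sqrt e| by near: e.
  have h2 : `|b e - b0| <= Cb * `|Num.sqrt e| by near: e.
  have h2' : `|d e| <= C1 * `|Num.sqrt e| by near: e.
  have h3 : Ca * `|Num.sqrt e| < g / 3 by near: e; exact: small.
  have h4 : Cb * `|Num.sqrt e| < g / 3 by near: e; exact: small.
  have h5 : C1 * `|Num.sqrt e| < g / 3 by near: e; exact: small.
  move: h1 h2 h2'; rewrite !ler_norml => /andP[? ?] /andP[? ?] /andP[? ?].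
  have : a0 - b0 = 2 * g by rewrite /g; field.
  lra.
have Dd : d e * g <= D.
  by have := ler_wpM2l d0e abd; have := sqr_ge0 (m e); rewrite /D; lra.
have D0 : 0 <= D by apply: le_trans Dd; rewrite mulr_ge0// ltW.
split => //; right.
have Cg : 0 <= C / g by rewrite divr_ge0// ltW.
have Cge : 0 <= C / g * e by exact: mulr_ge0.
rewrite -sqrtr_sqr -sqrtrM// -sqrtrM// ler_wsqrtr//.
move: dC; rewrite !ger0_norm// => dC.
apply: (@le_trans _ _ (C / g * e * (d e * g))); last exact: ler_wpM2l.
have gn0 : g != 0 by exact: lt0r_neq0.
have -> : C / g * e * (d e * g) = C * e * d e by field.
by rewrite expr2 ler_wpM2r.
Unshelve. all: by end_near. Qed.

(** The quantification over [P] and [w] comes after the choice of [M'], so that one rotation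
    accounts for all class traces at once. *)
Lemma plane_transfer (K : 'M[R]_(n, 2)) M x :
    let N0 := K^T *m A *m K in
    K^T *m K = 1%:M -> sqrt_close M ->
    (N0 0 1 != 0 /\ x =O_ (0^'+) Num.sqrt) \/
    [/\ N0 1 1 < N0 0 0, \forall e \near 0^'+, 0 <= x e &
        x =O_ (0^'+) (fun e : R => e)] ->
  exists2 M', sqrt_conj M M' & \forall e \near 0^'+,
    forall (P : 'M[R]_n) (w : 'rV[R]_2), P^T = P -> P *m K = K *m diag_mx w ->
    \tr (P *m M' e) = \tr (P *m M e) + (w 0 1 - w 0 0) * x e.
Proof.
move=> N0 KK [Msym MO] xO.
pose N e := K^T *m M e *m K.
have NO : mxO Num.sqrt (fun e => N e - N0).
  apply: mxO_near (mxO_mulr (mxO_mull (mxO_cst K^T) MO) (mxO_cst K)).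
  by apply: nearW => e; rewrite mulmxBr mulmxBl.
have NOij i j : (fun e => N e i j - N0 i j) =O_ (0^'+) Num.sqrt.
  suff -> : (fun e => N e i j - N0 i j) = (fun e => (N e - N0) i j) by exact: NO.
  by apply/funext => e; rewrite [RHS]mxE [X in _ = _ + X]mxE.
have [T T0 small] := small_angle (NOij 0 0) (NOij 1 1) (NOij 0 1) xO.
have /near_choice[r rP] : \forall e \near 0^'+, exists r : 'M[R]_2,
    [/\ is_orthogonal_mx r, forall i j, `|(r - 1%:M) i j| <= T * Num.sqrt e,
        (r *m N e *m r^T) 0 0 = N e 0 0 - x e &
        (r *m N e *m r^T) 1 1 = N e 1 1 + x e].
  apply: filterS2 Msym small => e Msym [D0 xD].
  have [|c [s [cs1 c1 s0 eq_x]]] := small_rotation D0 xD.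
    by rewrite mulr_ge0 ?sqrtr_ge0.
  have Nsym : (N e)^T = N e by rewrite /N !trmx_mul trmxK Msym mulmxA.
  have [N00 N11] := rot2_conj Nsym cs1.
  exists (rot2 c s); split.
  - exact: rot2_orthogonal.
  - move=> i j; rewrite !mxE; case: eqVneq => [_|ij] /=.
      by rewrite mulr1n.
    by rewrite mulr0n subr0; case: ifP; rewrite ?normrN.
  - by rewrite N00.
  (* Conjugation preserves the trace, so what the first entry loses the second gains. *)
  - by apply: (addrI (N e 0 0 - x e)); rewrite -{1}eq_x -N00 N11; ring.
pose G e := extend_mx K (r e).
exists (fun e => G e *m M e *m (G e)^T).
  exists G; split.
    by apply: filterS rP => e [rorth _ _ _]; split => //; exact: extend_mx_orthogonal.
  have rO : mxO Num.sqrt (fun e => r e - 1%:M).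
    move=> i j; apply/eqO_exP; exists (T + 1); first by rewrite ltr_wpDl.
    apply: filterS rP => e [_ /(_ i j) /le_trans + _ _]; apply.
    by rewrite ger0_norm ?sqrtr_ge0// ler_wpM2r ?sqrtr_ge0// lerDl.
  apply: mxO_near (mxO_mulr (mxO_mull (mxO_cst K) rO) (mxO_cst K^T)).
  by apply: nearW => e; rewrite /G /extend_mx [RHS]addrC addKr.
apply: filterS rP => e [rorth _ r00 r11] P w Psym PK.
rewrite (tr_extend_mx_conj (r e) KK (M e) Psym (tr_diag_mx w) PK) -/(N e).
move: (N e) (r e *m N e *m (r e)^T) r00 r11 => N2 N1 r00 r11.
congr (_ + _); rewrite mul_diag_mx /mxtrace !big_ord_recl big_ord0.
have -> : lift ord0 ord0 = 1 :> 'I_2 by apply: val_inj.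
rewrite -?[ord0]/(0 : 'I_2) !mxE r00 r11; ring.
Qed.
End transfers.

(** * Composing transfers between classes of indices *)

Section transferable.
Variables (R : realType) (n : nat) (A : 'M[R]_n) (eqv : rel 'I_n).
Implicit Types (M : R -> 'M[R]_n) (x : R -> R) (ok : (R -> R) -> Prop).

Definition class_trace (B : 'M[R]_n) l := \sum_(k | eqv l k) B k k.

(** [ok] restricts the amounts: sign and order of magnitude depend on the kind of move. [eqv] will
    be block membership, then equality of indices, for which the class traces are the diagonal
    entries. *)
Definition transferable ok i j := forall M x, sqrt_close A M -> ok x ->
  exists2 M', sqrt_conj M M' & \forall e \near 0^'+, forall l,
    class_trace (M' e) l =
    class_trace (M e) l + ((eqv l j)%:R - (eqv l i)%:R) * x e.

Lemma transferable_class ok i j :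
  (forall l, eqv l i = eqv l j) -> transferable ok i j.
Proof.
move=> ij M x _ _; exists M; first exact: sqrt_conj_refl.
by apply: nearW => e l; rewrite ij subrr mul0r addr0.
Qed.

Lemma transferable_trans ok i j k :
  transferable ok i j -> transferable ok j k -> transferable ok i k.
Proof.
move=> ij jk M x Mclose x_ok; have [M1 M1r M1E] := ij M x Mclose x_ok.
have [M2 M2r M2E] := jk M1 x (sqrt_conj_close Mclose M1r) x_ok.
exists M2; first exact: sqrt_conj_trans M1r M2r.
apply: filterS2 M1E M2E => e M1E M2E l; rewrite M2E M1E; ring.
Qed.

Lemma transferable_connect ok (r : rel 'I_n) i j :
  (forall a b, r a b -> transferable ok a b) ->
  connect r i j -> transferable ok i j.
Proof.
move=> rP /connectP[p + ->]; elim: p i => [|k p IHp] i /=.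
  by move=> _; exact: transferable_class.
by case/andP=> ik /IHp; apply: transferable_trans; exact: rP.
Qed.

(** The positive part of [x] is sent from [i] to [j] and the negative part back from [j] to [i]. *)
Lemma transferable_signed i j :
    let ok x := (\forall e \near 0^'+, 0 <= x e) /\ x =O_ (0^'+) (fun e : R => e) in
    transferable ok i j -> transferable ok j i ->
  transferable (fun x => x =O_ (0^'+) (fun e : R => e)) i j.
Proof.
move=> ok ij ji M x Mclose /eqO_exP[C C0 xO].
have okpos y : (forall e, `|y e| <= `|x e|) -> (forall e, 0 <= y e) -> ok y.
  move=> yx y0; split; first exact: nearW.
  by apply/eqO_exP; exists C => //; apply: filterS xO => e; exact: le_trans.
have [|M1 M1r M1E] := ij M (fun e => Num.max (x e) 0) Mclose.
  apply: okpos => e; last by rewrite le_max lexx orbT.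
  by case: (lerP (x e) 0) => [_|_]; rewrite ?normr0.
have [|M2 M2r M2E] := ji M1 (fun e => Num.max (- x e) 0) (sqrt_conj_close Mclose M1r).
  apply: okpos => e; last by rewrite le_max lexx orbT.
  by case: (lerP (- x e) 0) => [_|_]; rewrite ?normr0 ?normrN.
exists M2; first exact: sqrt_conj_trans M1r M2r.
apply: filterS2 M1E M2E => e M1E M2E l; rewrite M2E M1E.
have [x0|x0] := lerP (x e) 0.
  rewrite (@max_l _ _ (- x e)) ?oppr_ge0//; ring.
rewrite (@max_r _ _ (- x e)) ?oppr_le0 ?ltW//; ring.
Qed.

Lemma transfer_all ok (rho : 'I_n -> 'I_n) M (x : 'I_n -> R -> R) :
    (forall k, transferable ok k (rho k)) -> sqrt_close A M -> (forall k, ok (x k)) ->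
  exists2 M', sqrt_conj M M' & \forall e \near 0^'+, forall l,
    class_trace (M' e) l = class_trace (M e) l +
      \sum_k ((eqv l (rho k))%:R - (eqv l k)%:R) * x k e.
Proof.
move=> rhoP + x_ok; elim: (index_enum _) M => [|k s IHs] M Mclose.
  exists M; first exact: sqrt_conj_refl.
  by apply: nearW => e l; rewrite big_nil addr0.
have [M1 M1r M1E] := rhoP k M (x k) Mclose (x_ok k).
have [M2 M2r M2E] := IHs M1 (sqrt_conj_close Mclose M1r).
exists M2; first exact: sqrt_conj_trans M1r M2r.
by apply: filterS2 M1E M2E => e M1E M2E l; rewrite M2E M1E big_cons addrA.
Qed.

(* The amount sent from [k] to the representative [rho k] is the defect of the
   [k]-th diagonal entry: the class of [l] loses exactly its total defect, and
   receives a total that vanishes by the last hypothesis. *)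
Lemma balance ok (rho : 'I_n -> 'I_n) M :
    (forall k, transferable ok k (rho k)) -> sqrt_close A M ->
    (forall k, ok (fun e => M e k k - A k k)) ->
    (\forall e \near 0^'+, forall l,
      \sum_(k | eqv l (rho k)) (M e k k - A k k) = 0) ->
  exists2 M', sqrt_conj M M' &
    \forall e \near 0^'+, forall l, class_trace (M' e) l = class_trace A l.
Proof.
move=> rhoP Mclose x_ok sum0.
have [M' MM' M'E] := transfer_all rhoP Mclose x_ok; exists M' => //.
apply: filterS2 M'E sum0 => e M'E sum0 l; rewrite M'E.
under eq_bigr do rewrite mulrBl !mulr_natl.
rewrite sumrB; under eq_bigr do rewrite mulrb; rewrite -big_mkcond sum0 sub0r.
under eq_bigr do rewrite mulrb; rewrite -big_mkcond sumrB.
by rewrite opprB addrC subrK.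
Qed.

(** Each column of [K] is supported in a single class, so every class indicator multiplies it by [0]
    or [1], as [plane_transfer] demands of [P]. *)
Lemma transferable_plane ok i j (K : 'M[R]_(n, 2)) :
    let N := K^T *m A *m K in
    K^T *m K = 1%:M ->
    (forall l k, K k 0 != 0 -> eqv l k = eqv l i) ->
    (forall l k, K k 1 != 0 -> eqv l k = eqv l j) ->
    (forall x, ok x -> (N 0 1 != 0 /\ x =O_ (0^'+) Num.sqrt) \/
      [/\ N 1 1 < N 0 0, \forall e \near 0^'+, 0 <= x e &
        x =O_ (0^'+) (fun e : R => e)]) ->
  transferable ok i j.
Proof.
move=> N KK Ki Kj okP M x Mclose /okP xO.
have [M' MM' M'E] := plane_transfer KK Mclose xO; exists M' => //.
apply: filterS M'E => e M'E l.
pose p : 'rV[R]_n := \row_k (eqv l k)%:R.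
have trE B : class_trace B l = \tr (diag_mx p *m B).
  rewrite mul_diag_mx /mxtrace /class_trace big_mkcond.
  by apply: eq_bigr => k _; rewrite !mxE mulr_natl mulrb.
pose w : 'rV[R]_2 := \row_a (eqv l (if a == 0 then i else j))%:R.
rewrite !trE (M'E _ w) ?tr_diag_mx ?mxE//.
rewrite mul_diag_mx mul_mx_diag; apply/matrixP => k a; rewrite !mxE mulrC.
have [->|Kka] := eqVneq (K k a) 0; first by rewrite !mul0r.
congr (_ * _%:R); move: a Kka => [[|[|//]] a_lt] /= Kka; congr nat_of_bool.
  by apply: Ki; apply: contraNneq Kka => <-; apply/eqP; congr (K _ _); apply: val_inj.
by apply: Kj; apply: contraNneq Kka => <-; apply/eqP; congr (K _ _); apply: val_inj.
Qed.
End transferable.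

(** * Blocks of [A], and the moves inside and between them *)

Section blocks.
Variables (R : realType) (n : nat) (A : 'M[R]_n).
Hypothesis A_sym : A^T = A.

Definition support_rel : rel 'I_n := [rel i j | A i j != 0].
Local Notation block := (connect support_rel).

Lemma block_sym : connect_sym support_rel.
Proof.
by apply: sym_connect_sym => i j; rewrite /support_rel /= -[in LHS]A_sym mxE.
Qed.

(** Rotation in the plane of the coordinate vectors [i] and [j], whose off-diagonal coefficient is
    [A i j]. *)
Lemma transferable_support i j : support_rel i j ->
  transferable A eq_op (fun x => x =O_ (0^'+) Num.sqrt) i j.
Proof.
move=> Aij; have [<-|ij] := eqVneq i j; first exact: transferable_class.
pose f (a : 'I_2) := if a == 0 then i else j.
pose K : 'M[R]_(n, 2) := colsub f 1%:M.
have KX X : K^T *m X *m K = mxsub f f X.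
  by rewrite /K trmx_mxsub trmx1 -rowsubE mulmx_colsub mulmx1;
    apply/matrixP => a b; rewrite !mxE.
have KE k a : (K k a != 0) = (k == f a).
  rewrite !mxE /=; case: (k == f a); by rewrite ?oner_eq0 ?eqxx.
apply: (@transferable_plane _ _ _ _ _ _ _ K).
- rewrite -[K^T]mulmx1 KX; apply/matrixP => a b; rewrite !mxE; congr (_%:R).
  case: a => [[|[|//]] ?]; case: b => [[|[|//]] ?]; rewrite /f /= ?eqxx//.
    by rewrite (negPf ij).
  by rewrite eq_sym (negPf ij).
- by move=> l k; rewrite KE => /eqP ->.
- by move=> l k; rewrite KE => /eqP ->.
- by move=> x xO; left; split => //; rewrite KX mxE.
Qed.

Variables Q Lambda : 'M[R]_n.
Hypothesis A_eig : is_eigendecomposition A Q Lambda.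

(* Cut down to the block of [i], the column [k] of [Q] is still an eigenvector of
   [A] for [Lambda k k], provided that it is nonzero. *)
Definition block_meets i k := [exists y, block i y && (Q y k != 0)].

Definition spectral_rel : rel 'I_n := [rel i j | block i j ||
  [exists k, [exists l, [&& block_meets i k, block_meets j l &
    Lambda l l < Lambda k k]]]].

(** For distinct blocks, the plane is spanned by the normalised projections of eigenvectors [k] and
    [l] on the blocks of [i] and [j]. Disjoint supports make them orthogonal, and the compression of
    [A] is diagonal with entries [Lambda k k > Lambda l l]. *)
Lemma transferable_spectral i j : spectral_rel i j ->
  transferable A block (fun x => (\forall e \near 0^'+, 0 <= x e) /\
                                 x =O_ (0^'+) (fun e : R => e)) i j.
Proof.
have [ij _|ij] := boolP (block i j).
  by apply: transferable_class => l; exact: (same_connect_r block_sym).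
rewrite /spectral_rel /= (negPf ij) /= => /existsP[k /existsP[l /and3P[ik jl kl]]].
have [Qorth /is_diag_mxP Ldiag AE] := A_eig.
have AQ : A *m Q = Q *m Lambda.
  by rewrite AE -mulmxA (mulmx1C Qorth) mulmx1.
have AQE y c : \sum_z A y z * Q z c = Q y c * Lambda c c.
  have /matrixP/(_ y c) := AQ; rewrite !mxE => ->.
  rewrite (bigD1 c)//= big1 ?addr0// => z zc.
  by rewrite Ldiag ?mulr0.
pose I (a : 'I_2) := if a == 0 then i else j.
pose C (a : 'I_2) := if a == 0 then k else l.
pose u a y : R := (block (I a) y)%:R * Q y (C a).
pose nu a := Num.sqrt (\sum_y u a y ^+ 2).
have sum0 a : 0 <= \sum_y u a y ^+ 2 by apply: sumr_ge0 => y _; exact: sqr_ge0.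
have nu_neq0 a : nu a != 0.
  have /existsP[y /andP[Iy Qy]] : block_meets (I a) (C a).
    by rewrite /I /C; case: ifP.
  rewrite sqrtr_eq0 -ltNge (bigD1 y)//=.
  rewrite ltr_pwDl ?sumr_ge0// => [|z _]; last exact: sqr_ge0.
  by rewrite exprn_even_gt0//= /u Iy mul1r.
pose K : 'M[R]_(n, 2) := \matrix_(y, a) (u a y / nu a).
have Kblock y a : K y a != 0 -> block (I a) y.
  by rewrite mxE /u; case: (block _ _) => //; rewrite !mul0r eqxx.
have KK : K^T *m K = 1%:M.
  apply/matrixP => a b; rewrite !mxE.
  have [<-|ab] := eqVneq a b.
    under eq_bigr do rewrite !mxE -expr2 expr_div_n.
    rewrite -mulr_suml -(sqr_sqrtr (sum0 a)) divff//.
    by apply: expf_neq0; exact: nu_neq0.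
  apply: big1 => y _; rewrite [K^T a y]mxE.
  have [->|Ka] := eqVneq (K y a) 0; first by rewrite mul0r.
  have [->|Kb] := eqVneq (K y b) 0; first by rewrite mulr0.
  case/negP: ij; have Iab : block (I a) (I b).
    by apply: connect_trans (Kblock _ _ Ka) _; rewrite block_sym; exact: Kblock.
  move: ab Iab; rewrite /I.
  case: a {Ka} => [[|[|//]] ?]; case: b {Kb} => [[|[|//]] ?] //= _.
  by rewrite block_sym.
pose w : 'rV[R]_2 := \row_a Lambda (C a) (C a).
have AK : A *m K = K *m diag_mx w.
  rewrite mul_mx_diag; apply/matrixP => y a; rewrite !mxE /u.
  have -> : (block (I a) y)%:R * Q y (C a) / nu a * Lambda (C a) (C a) =
      (block (I a) y)%:R / nu a * (Q y (C a) * Lambda (C a) (C a)) by ring.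
  rewrite -AQE mulr_sumr; apply: eq_bigr => z _; rewrite mxE /u.
  have [->|Ayz] := eqVneq (A y z) 0; first by rewrite !mul0r mulr0.
  (* A nonzero [A y z] puts [y] and [z] in one block: block indicators commute with [A]. *)
  have -> : block (I a) y = block (I a) z.
    exact/(same_connect_r block_sym)/connect1.
  ring.
apply: (@transferable_plane _ _ _ _ _ _ _ K) => //.
- move=> m y /Kblock Iy; apply/esym/(same_connect_r block_sym).
  exact: Iy.
- move=> m y /Kblock Iy; apply/esym/(same_connect_r block_sym).
  exact: Iy.
- move=> x [x0 xO]; right; split => //.
  by rewrite -mulmxA AK mulmxA KK mul1mx !mxE.
Qed.

Lemma balance_blocks M : (forall i j, connect spectral_rel i j) ->
    sqrt_close A M -> mxO (fun e => e) (fun e => M e - A) ->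
    (\forall e \near 0^'+, \tr (M e) = \tr A) ->
  exists2 M', sqrt_conj M M' & \forall e \near 0^'+, forall l,
    class_trace block (M' e) l = class_trace block A l.
Proof.
move=> conn Mclose MO trM.
have [i0 _|n0] := pickP 'I_n; last first.
  exists M; first exact: sqrt_conj_refl.
  by apply: nearW => e l; have := n0 l; rewrite inE.
(* All defects are sent to the single index [i0]; their sum is the defect of the full trace, which
   is zero. *)
apply: (@balance _ _ _ _ (fun x => x =O_ (0^'+) (fun e : R => e)) (fun=> i0)) => //.
- move=> k; apply: transferable_signed;
    exact: transferable_connect transferable_spectral (conn _ _).
- move=> k; have := MO k k.
  by have -> : (fun e => (M e - A) k k) = (fun e => M e k k - A k k)
    by apply/funext => e; rewrite !mxE.
- apply: filterS trM => e trM l; case: (block l i0); last by rewrite big_pred0.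
  by rewrite sumrB -[X in X - _]/(\tr (M e)) trM subrr.
Qed.

(** Each block gathers its defects at its root, where they cancel because the block trace is already
    right. *)
Lemma balance_diagonal M : sqrt_close A M ->
    (\forall e \near 0^'+, forall l,
      class_trace block (M e) l = class_trace block A l) ->
  exists2 M', sqrt_conj M M' & \forall e \near 0^'+, forall l, M' e l l = A l l.
Proof.
move=> Mclose trM.
have [||||M' MM' M'E] := @balance _ _ A eq_op (fun x => x =O_ (0^'+) Num.sqrt)
  (fingraph.root support_rel) M.
- move=> k; apply: transferable_connect transferable_support _.
  exact: connect_root.
- exact: Mclose.
- move=> k; have := Mclose.2 k k.
  by have -> : (fun e => (M e - A) k k) = (fun e => M e k k - A k k)
    by apply/funext => e; rewrite !mxE.
- apply: filterS trM => e trM l.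
  (* An index that is not a root receives nothing: the sum is empty. *)
  have [lroot|lroot] := boolP (roots support_rel l); last first.
    rewrite big_pred0// => k; apply: contraNF lroot => /eqP ->.
    exact: (roots_root block_sym).
  rewrite (eq_bigl (block l)); last first.
    by move=> k; rewrite -(root_connect block_sym) (eqP lroot).
  by rewrite sumrB; apply/eqP; rewrite subr_eq0; apply/eqP; exact: trM.
- exists M' => //; apply: filterS M'E => e M'E l.
  have diagE B : class_trace eq_op B l = B l l.
    by rewrite /class_trace (big_pred1 l)// => k; rewrite /= eq_sym.
  by rewrite -!diagE.
Qed.
End blocks.

(** * Consequences of strict majorization for subsets of indices *)

(* Bathtub principle: [c] is a threshold value of [f], and [w'] is obtained from
   [w] by moving mass from values below [c] to values above [c]. *)
Lemma weighted_sum_le (R : realType) (I : finType) (f w w' : I -> R) (c : R) :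
    \sum_i w i = \sum_i w' i -> (forall i, (w i - w' i) * (f i - c) <= 0) ->
  \sum_i w i * f i <= \sum_i w' i * f i.
Proof.
move=> ww' le0; rewrite -subr_le0 -sumrB.
have -> : \sum_i (w i * f i - w' i * f i) = \sum_i (w i - w' i) * (f i - c).
  under [RHS]eq_bigr do rewrite mulrBr !mulrBl.
  by rewrite [RHS]sumrB [X in _ = _ - X]sumrB -!mulr_suml ww' subrr subr0.
exact: sumr_le0.
Qed.

Lemma perm_eq_family (T : eqType) (n : nat) (x0 : T) (s : n.-tuple T) (f : 'I_n -> T) :
  perm_eq s [seq f i | i : 'I_n] ->
  exists p : 'S_n, forall i : 'I_n, nth x0 s i = f (p i).
Proof.
have -> : [seq f i | i : 'I_n] = [tuple f i | i < n] by rewrite /image_mem -val_ord_tuple.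
move=> /tuple_permP[p ->]; exists p => i.
by rewrite -tnth_nth !tnth_mktuple.
Qed.

Lemma sum_ord_lt (R : pzSemiRingType) (m n : nat) (F : nat -> R) : (m <= n)%N ->
  \sum_(i < m) F i = \sum_(i < n) (i < m)%:R * F i.
Proof.
move=> mn; rewrite (big_ord_widen n F mn) big_mkcond; apply: eq_bigr => i _.
by rewrite mulr_natl mulrb.
Qed.

Lemma sum_ord_lt1 (R : pzSemiRingType) (m n : nat) : (m <= n)%N ->
  \sum_(i < n) (i < m)%:R = m%:R :> R.
Proof.
move=> /(sum_ord_lt (fun=> 1 : R)) => h; rewrite -[RHS]mulr1n.
rewrite -[in RHS](card_ord m) -sumr_const h.
by apply: eq_bigr => i _; rewrite mulr1.
Qed.

Section cut.
Variables (R : realType) (n : nat) (A Q Lambda : 'M[R]_n).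
Hypothesis A_eig : is_eigendecomposition A Q Lambda.

(** Identifies the prescribed spectrum with the diagonal of an arbitrary [Lambda], up to order. *)
Lemma char_poly_eigendecomposition :
  char_poly A = \prod_(i < n) ('X - (Lambda i i)%:P).
Proof.
have [Qorth Ldiag ->] := A_eig.
have QX : map_mx polyC Q *m map_mx polyC Q^T = 1%:M.
  by rewrite -map_mxM Qorth map_mx1.
rewrite -(char_poly_trig (is_diag_mx_is_trig Ldiag)) /char_poly /char_poly_mx.
have -> : 'X%:M - map_mx polyC (Q *m Lambda *m Q^T) =
    map_mx polyC Q *m ('X%:M - map_mx polyC Lambda) *m map_mx polyC Q^T.
  rewrite mulmxBr mulmxBl -!map_mxM; congr (_ - _).
  by rewrite scalar_mxC -mulmxA QX mulmx1.
by rewrite !det_mulmx mulrAC -det_mulmx QX det1 mul1r.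
Qed.

(** The trace of [A] over [S] is the sum of the [Lambda k k] with weights [w k] in [[0, 1]] of total
    [#|S|]. Without a cut these weights fill the lowest eigenvalues first, so this trace is at most
    the partial sum of [lambda]; it is also at least that of [d], a contradiction. *)
Lemma majorization_cut (lambda d : n.-tuple R) (S : {set 'I_n}) :
    perm_eq lambda [seq Lambda i i | i : 'I_n] ->
    sorted <=%R d -> perm_eq d [seq A i i | i : 'I_n] ->
    \sum_(i < #|S|) lambda`_i < \sum_(i < #|S|) d`_i ->
    (0 < #|S| < n)%N ->
  exists x y k l, [/\ x \in S, y \notin S, Q x k != 0, Q y l != 0 &
    Lambda l l < Lambda k k].
Proof.
move=> /(perm_eq_family 0)[p pE] d_sorted /(perm_eq_family 0)[q qE] lt_ld /andP[S0 Sn].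
set m := #|S| in lt_ld S0 Sn; apply: contrapT => no_cut.
have [Qorth /is_diag_mxP Ldiag AE] := A_eig.
have Qrow x : \sum_k Q x k ^+ 2 = 1.
  have /matrixP/(_ x x) := Qorth; rewrite !mxE eqxx => eq1; apply: etrans eq1.
  by apply: eq_bigr => k _; rewrite mxE.
have Qcol k : \sum_x Q x k ^+ 2 = 1.
  have /matrixP/(_ k k) := mulmx1C Qorth; rewrite !mxE eqxx => eq1; apply: etrans eq1.
  by apply: eq_bigr => x _; rewrite mxE.
have AxxE x : A x x = \sum_k Q x k ^+ 2 * Lambda k k.
  rewrite AE mxE; apply: eq_bigr => k _; rewrite !mxE (bigD1 k)//= big1 => [|z zk].
    by rewrite addr0; ring.
  by rewrite Ldiag ?mulr0.
pose w k := \sum_(x in S) Q x k ^+ 2.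
have trS : \sum_(x in S) A x x = \sum_k w k * Lambda k k.
  under eq_bigr do rewrite AxxE.
  by rewrite exchange_big; apply: eq_bigr => k _; rewrite mulr_suml.
have sum_w : \sum_k w k = m%:R.
  rewrite exchange_big /= (eq_bigr (fun=> 1)) => [|x _]; last exact: Qrow.
  by rewrite sumr_const.
have w0 k : 0 <= w k by apply: sumr_ge0 => x _; exact: sqr_ge0.
have w1 k : 1 - w k = \sum_(x | x \notin S) Q x k ^+ 2.
  by rewrite -(Qcol k) (bigID (mem S))/= addrC addrK.
have w_le1 k : w k <= 1.
  by rewrite -subr_ge0 w1; apply: sumr_ge0 => x _; exact: sqr_ge0.
have nz (P : pred 'I_n) k : \sum_(x | P x) Q x k ^+ 2 != 0 ->
    exists2 x, P x & Q x k != 0.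
  move=> nz; apply/exists_inP; apply: contra_neqT nz => /exists_inPn Q0.
  apply: big1 => x /Q0; rewrite negbK => /eqP ->; exact: expr0n.
have Lambda_le k l : w k != 0 -> w l != 1 -> Lambda k k <= Lambda l l.
  move=> /nz[x xS Qxk]; rewrite eq_sym -subr_eq0 w1 => /nz[y yS Qyl].
  rewrite leNgt; apply/negP => lt_lk; apply: no_cut.
  by exists x, y, k, l.
have lambda_ge : \sum_(x in S) A x x <= \sum_(i < m) lambda`_i.
  have [k0 wk0] : exists k, w k != 0.
    apply/existsP; apply: contraT => /existsPn w_eq0.
    have : (m%:R : R) = 0 by rewrite -sum_w big1// => k _; apply/eqP; rewrite -[_ == _]negbK.
    by move=> /eqP; rewrite pnatr_eq0 => /eqP m0; rewrite m0 in S0.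
  (* Threshold: the largest eigenvalue carrying weight. By [Lambda_le], every index of weight other
     than [1] lies at or above it. *)
  pose c := [arg max_(k > k0 | w k != 0) Lambda k k]%O.
  have [wc c_max] : w c != 0 /\ forall k, w k != 0 -> Lambda k k <= Lambda c c.
    by rewrite /c; case: arg_maxP.
  rewrite trS (sum_ord_lt (fun i => lambda`_i) (ltnW Sn)).
  under [leRHS]eq_bigr do rewrite pE.
  rewrite [leLHS](reindex_inj (@perm_inj _ p)) /=.
  apply: (@weighted_sum_le _ _ _ _ _ (Lambda c c)).
    rewrite sum_ord_lt1 ?(ltnW Sn)// -sum_w.
    by rewrite [RHS](reindex_inj (@perm_inj _ p)).
  move=> i; have [_|_] := ltnP i m; rewrite /= ?subr0.
    have [->|w_neq1] := eqVneq (w (p i)) 1; first by rewrite subrr mul0r.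
    by rewrite mulr_le0_ge0 ?subr_le0 ?subr_ge0 ?w_le1 ?Lambda_le.
  have [->|w_neq0] := eqVneq (w (p i)) 0; first by rewrite mul0r.
  by rewrite mulr_ge0_le0 ?subr_le0 ?c_max.
have d_le : \sum_(i < m) d`_i <= \sum_(x in S) A x x.
  rewrite (sum_ord_lt (fun i => d`_i) (ltnW Sn)) [leRHS]big_mkcond.
  rewrite [leRHS](reindex_inj (@perm_inj _ q)) /=.
  rewrite [leRHS](eq_bigr (fun i : 'I_n => (q i \in S)%:R * d`_i)) => [|i _]; last first.
    by rewrite qE mulr_natl mulrb.
  apply: (@weighted_sum_le _ _ _ _ _ d`_m).
    rewrite sum_ord_lt1 ?(ltnW Sn)//.
    rewrite /m -sumr_const big_mkcond [LHS](reindex_inj (@perm_inj _ q)).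
    by apply: eq_bigr => i _; rewrite mulrb.
  have d_mono i j : (i <= j)%N -> (j < n)%N -> d`_i <= d`_j.
    move=> ij jn; apply: (sorted_leq_nth le_trans le_refl) => //; rewrite inE size_tuple//.
    exact: leq_ltn_trans jn.
  move=> i; have [im|im] := ltnP i m.
    rewrite mulr_ge0_le0 ?subr_le0 ?d_mono ?(ltnW im)//.
    by rewrite subr_ge0; case: (_ \in _) => //=; rewrite ler01.
  rewrite mulr_le0_ge0 ?subr_ge0 ?d_mono//.
  by rewrite sub0r oppr_le0.
by have := lt_le_trans lt_ld (le_trans d_le lambda_ge); rewrite ltxx.
Qed.
End cut.

(** * Strong connectivity of the moves, and assembly of [G2] *)

Theorem proposition3p10 (R : realType) (n : nat) (A : 'M[R]_n)
    (lambda d : n.-tuple R)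
    (A_sym : A \is symmetricmx)
    (lambda_sorted : sorted <=%R lambda)
    (lambda_eigenvalues : char_poly A = \prod_(x <- lambda) ('X - x%:P))
    (d_sorted : sorted <=%R d)
    (d_diagonal : perm_eq d [seq A i i | i : 'I_n])
    (strict_majorization : forall k : nat, (0 < k < n)%N ->
       \sum_(i < k) lambda`_i < \sum_(i < k) d`_i)
    (total_equality : \sum_(i < n) lambda`_i = \sum_(i < n) d`_i) :
  strongly_Schur_Horn_continuous A.
Proof.
split=> // Q Lambda A_eig Lambda_t Lt_diag Lt_O.
have symP (B : 'M[R]_n) : (B \is symmetricmx) = (B^T == B).
  by rewrite qualifE /= scale1r map_mx_id// eq_sym.
have AT : A^T = A by apply/eqP; rewrite -symP.
have [Qorth /is_diag_mxP Ldiag AE] := A_eig.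
have lambda_perm : perm_eq lambda [seq Lambda i i | i : 'I_n].
  apply: prod_XsubC_eq; rewrite -lambda_eigenvalues.
  by rewrite (char_poly_eigendecomposition A_eig) big_image.
have conn i j : connect (spectral_rel A Q Lambda) i j.
  (* If [j] were unreachable from [i], the set [S] of reachable indices would be proper and
     nonempty, and the cut would give an edge leaving it. *)
  pose S : {set 'I_n} := [set k | connect (spectral_rel A Q Lambda) i k]%SET.
  apply: contraT => jS.
  have iS : i \in S by rewrite inE connect0.
  have S0 : (0 < #|S|)%N by apply/card_gt0P; exists i.
  have Sn : (#|S| < n)%N.
    rewrite -[X in (_ < X)%N](card_ord n) -cardsT; apply: proper_card.
    by rewrite properT; apply: contraNneq jS => ST; have : j \in S;
      [rewrite ST finset.in_setT | rewrite inE].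
  have S0n : (0 < #|S| < n)%N by rewrite S0.
  have [x [y [k [l [xS yS Qxk Qyl lt_lk]]]]] := majorization_cut A_eig lambda_perm
    d_sorted d_diagonal (strict_majorization _ S0n) S0n.
  case/negP: yS; move: xS; rewrite !inE => xS; apply: connect_trans xS _; apply: connect1.
  apply/orP; right; apply/existsP; exists k; apply/existsP; exists l.
  by rewrite lt_lk andbT; apply/andP; split; apply/existsP; [exists x | exists y];
    rewrite connect0.
pose M e := Q *m Lambda_t e *m Q^T.
have MO : mxO (fun e => e) (fun e => M e - A).
  have LO := (mxO_frobenius _ _).1 Lt_O.
  apply: mxO_near (mxO_mulr (mxO_mull (mxO_cst Q) LO) (mxO_cst Q^T)).
  by apply: nearW => e; rewrite mulmxBr mulmxBl -AE.
have Mclose : sqrt_close A M.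
  split; last by move=> i j; exact/eqO_id_sqrt/MO.
  apply: filterS Lt_diag => e [/is_diag_mxP Ltd _]; rewrite !trmx_mul trmxK mulmxA.
  congr (_ *m _ *m _); apply/matrixP => i j; rewrite mxE.
  by have [->//|ij] := eqVneq i j; rewrite !Ltd// eq_sym.
have trM : \forall e \near 0^'+, \tr (M e) = \tr A.
  apply: filterS Lt_diag => e [_ trL].
  have trE (B : 'M[R]_n) : \tr (Q *m B *m Q^T) = \tr B.
    by rewrite mxtrace_mulC mulmxA (mulmx1C Qorth) mul1mx.
  by rewrite AE /M !trE.
have [M1 MM1 M1E] := balance_blocks AT A_eig conn Mclose MO trM.
have [M2 M12 M2E] := balance_diagonal AT (sqrt_conj_close Mclose MM1) M1E.
have [G [GM GO]] := sqrt_conj_trans MM1 M12.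
exists M2, (fun=> 1%:M), G; split; last exact/mxO_frobenius.
  have M2sym := (sqrt_conj_close (sqrt_conj_close Mclose MM1) M12).1.
  near=> e; have [Gorth M2e] : is_orthogonal_mx (G e) /\ M2 e = G e *m M e *m (G e)^T.
    by near: e.
  split => //.
  - by rewrite symP; apply/eqP; near: e.
  - by rewrite M2e /M trmx1 !mulmx1 !mulmxA.
  - by apply/rowP => i; rewrite !mxE; move: i; near: e.
  - by rewrite /is_orthogonal_mx trmx1 mulmx1.
apply/mxO_frobenius => i j; apply/eqO_exP; exists 1 => //; apply: nearW => e.
by rewrite subrr mxE normr0 mulr_ge0.
Unshelve. all: by end_near. Qed.
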